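(* Let $n,m\ge 1$. The number of plane labelled bipartite trees with $n$ white vertices and $m$ black vertices equals $$\frac{\bigl((n+m-2)!\bigr)^2}{(n-1)!\,(m-1)!}.$$
   Context: A plane tree is a finite tree embedded in the oriented plane. Two such trees are identified if an orientation-preserving homeomorphism of the plane carries one onto the other; equivalently, a plane tree is a tree together with a cyclic order of the edges at each vertex. A bipartite tree is a tree whose vertices are colored black and white so that adjacent vertices have different colors. A plane labelled bipartite tree with $n$ white and $m$ black vertices is a plane bipartite tree in which the white vertices carry the distinct labels $v_1,\dots,v_n$ and the black vertices carry the distinct labels $u_1,\dots,u_m$ (each label used exactly once). Two such labelled trees are identified if an orientation-preserving homeomorphism of the plane maps one onto the other, preserving colors and labels. Such a tree has $n+m-1$ edges. *)

(* Defs.v *)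
From mathcomp Require Import all_boot all_fingroup.
Set Implicit Arguments. Unset Strict Implicit. Unset Printing Implicit Defensive.

(* Vertices: white v_i = inl i (i : 'I_n), black u_j = inr j (j : 'I_m).
   Since a bipartite tree only has white-black edges and no multiple edges,
   an edge is a pair (i, j) : 'I_n * 'I_m, and the edge set is E : {set 'I_n * 'I_m}. *)

Definition btree_adj (n m : nat) (E : {set 'I_n * 'I_m}) : rel ('I_n + 'I_m) :=
  fun x y => match x, y with
             | inl i, inr j => (i, j) \in E
             | inr j, inl i => (i, j) \in E
             | _, _ => false
             end.

Definition is_btree (n m : nat) (E : {set 'I_n * 'I_m}) : bool :=
  [forall x, forall y, connect (btree_adj E) x y] && (#|E| == (n + m).-1).

(* s : a permutation of the edges (darts of one colour) that is a cyclic order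
   of the edges around each vertex of colour given by [side]:
   - s fixes the non-edges, maps edges to edges at the same vertex,
   - for each vertex, the edges at it form a single cycle of s. *)
Definition is_rotation (n m : nat) (T : finType) (side : 'I_n * 'I_m -> T)
  (E : {set 'I_n * 'I_m}) (s : {perm 'I_n * 'I_m}) : bool :=
  [forall e, (e \notin E) ==> (s e == e)] &&
  [forall e, (e \in E) ==> ((s e \in E) && (side (s e) == side e))] &&
  [forall e, forall e', [&& e \in E, e' \in E & side e == side e'] ==>
                        fconnect s e e'].

Definition plane_lbtree (n m : nat)
  (t : {set 'I_n * 'I_m} * {perm 'I_n * 'I_m} * {perm 'I_n * 'I_m}) : bool :=
  let: (E, sw, sb) := t in
  [&& is_btree E, is_rotation (fun e => e.1) E sw & is_rotation (fun e => e.2) E sb].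

(* Main.v *)
Require Import Defs.
From mathcomp Require Import all_boot all_fingroup.
From mathcomp Require Import zify.
Set Implicit Arguments. Unset Strict Implicit. Unset Printing Implicit Defensive.

(** The number of plane structures on a tree is the product of [(deg v - 1)!]
    over its vertices [v]. Fix a prescribed degree [d v >= 1] for every vertex of
    a tree with [s] vertices of one colour and [o] of the other. Some [d x] is 1,
    say with [x] of the first colour; deleting the leaf [x], attached to [y],
    lowers [d y] by one and divides the weight by [d y - 1]. Since the numbers
    [d y - 1] over the colour opposite to [x] add up to [s - 1], induction shows
    that the plane trees with degrees [d] number [(s - 1)! (o - 1)!], whatever
    [d] is. It remains to count the degree sequences, which are compositions. *)

(** * Reachability along a relation or a permutation *)

Lemma connect_invariant (T : finType) (e : rel T) (P : T -> Prop) x y :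
  (forall u v, P u -> e u v -> P v) -> P x -> connect e x y -> P y.
Proof.
move=> eP Px /connectP[p + ->]; elim: p x Px => //= z p IHp x Px /andP[xz zp].
by apply: IHp zp; apply: eP xz.
Qed.

Lemma fconnect_perm_sym (T : finType) (s : {perm T}) x y :
  fconnect s x y = fconnect s y x.
Proof. exact/fconnect_sym/perm_inj. Qed.

(** * Counting the cyclic orders at the vertices of one colour *)

Section Rotations.
Variables (n m : nat) (T : finType) (side : 'I_n * 'I_m -> T).
Implicit Types (E : {set 'I_n * 'I_m}) (s : {perm 'I_n * 'I_m}).

Lemma is_rotationP E s :
  reflect [/\ forall e, e \notin E -> s e = e,
              forall e, e \in E -> s e \in E /\ side (s e) = side e
            & forall e e', e \in E -> e' \in E -> side e = side e' ->
                fconnect s e e']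
          (is_rotation side E s).
Proof.
apply: (iffP idP) => [|[fixE stabE connE]].
  case/andP=> /andP[/forallP fixE /forallP stabE] /forallP connE.
  split=> [e Ee|e Ee|e e' Ee Ee' see'].
  - exact/eqP/(implyP (fixE e)).
  - by have /andP[-> /eqP ->] := implyP (stabE e) Ee.
  - by apply: (implyP (forallP (connE e) e')); rewrite Ee Ee' see' eqxx.
apply/andP; split; first (apply/andP; split).
- by apply/forallP=> e; apply/implyP=> /fixE/eqP.
- by apply/forallP=> e; apply/implyP=> /stabE[-> ->]; rewrite eqxx.
- apply/forallP=> e; apply/forallP=> e'; apply/implyP=> /and3P[? ? /eqP].
  exact: connE.
Qed.

(* [tperm e' e * s] inserts [e] right after [e'] in the cycle of [e']. *)
Lemma is_rotation_insert E s e e' :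
    e \in E -> e' \in E -> e' != e -> side e' = side e ->
  is_rotation side E (tperm e' e * s)%g && ((tperm e' e * s)%g e' == e) =
  is_rotation side (E :\ e) s.
Proof.
move=> Ee Ee' e'e see'; set r := (tperm e' e * s)%g.
have re' : r e' = s e by rewrite permM tpermL.
have re : r e = s e' by rewrite permM tpermR.
have rD z : z != e -> z != e' -> r z = s z.
  by move=> ze ze'; rewrite permM tpermD // eq_sym.
apply/andP/is_rotationP => [[/is_rotationP[fixE stabE connE] /eqP re'e]|].
  have se : s e = e by rewrite -re'.
  split=> [z|z|x y].
  - rewrite !inE negb_and negbK => /orP[/eqP -> //|Ez].
    by rewrite -rD ?fixE //; apply: contraNneq Ez => ->.
  - rewrite !inE => /andP[ze Ez].
    have sze : s z != e by rewrite -[X in _ != X]se (inj_eq perm_inj).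
    rewrite sze /=; have [-> | ze'] := eqVneq z e'.
      by rewrite -re see'; apply: stabE.
    by rewrite -rD //; apply: stabE.
  - rewrite !inE => /andP[xe Ex] /andP[ye Ey] sxy.
    (* Since [r] runs through [e'], [e], [s e'], replacing [e] by its predecessor [e'] turns a path
       of [r] into a path of [s]. *)
    pose P z := fconnect s x (if z == e then e' else z).
    have: P y; last by rewrite /P (negPf ye).
    apply: (@connect_invariant _ (frel r) P x y) (connE _ _ Ex Ey sxy).
      move=> u v Pu /eqP <-; move: Pu; rewrite /P.
      have [-> | ue] := eqVneq u e => Pu.
        rewrite re -[X in s e' == X]se (inj_eq perm_inj) (negPf e'e).
        exact: connect_trans Pu (fconnect1 _ _).
      have [ue' | ue'] := eqVneq u e'.
        by rewrite ue' re'e eqxx -ue'.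
      rewrite rD // -[X in s u == X]se (inj_eq perm_inj) (negPf ue).
      exact: connect_trans Pu (fconnect1 _ _).
    by rewrite /P (negPf xe) connect0.
case=> fixE stabE connE.
have se : s e = e by apply: fixE; rewrite !inE eqxx.
have re'e : r e' = e by rewrite re'.
have E'e' : e' \in E :\ e by rewrite !inE e'e.
have rs x y : fconnect s x y -> fconnect r x y.
  apply: connect_sub => u v /eqP <-{v}.
  have [-> | ue] := eqVneq u e; first by rewrite se connect0.
  have [-> | ue'] := eqVneq u e'; last by rewrite -rD // fconnect1.
  (* The single step of [s] from [e'] to [s e'] is two steps of [r], through [e]. *)
  by rewrite -re -re'e; apply: connect_trans (fconnect1 _ _) (fconnect1 _ _).
have toe' x : x \in E -> side x = side e -> fconnect r x e'.
  move=> Ex sx; have [-> | xe] := eqVneq x e.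
    by rewrite fconnect_perm_sym -[X in fconnect r e' X]re'e fconnect1.
  by apply/rs/connE => //; rewrite ?inE ?xe ?sx.
split; last by rewrite re'e.
apply/is_rotationP; split=> [z Ez|z Ez|x y Ex Ey sxy].
- rewrite rD ?fixE // ?inE ?(negPf Ez) ?andbF //;
    by apply: contraNneq Ez => ->.
- have [-> | ze] := eqVneq z e.
    by rewrite re -see'; case: (stabE _ E'e') => /setD1P[_].
  have [-> | ze'] := eqVneq z e'; first by rewrite re'e.
  by rewrite rD //; case: (stabE z) => [|/setD1P[_]] //; rewrite !inE ze.
- have [sx | sx] := eqVneq (side x) (side e).
    apply: connect_trans (toe' _ Ex sx) _.
    by rewrite fconnect_perm_sym; apply: toe'; rewrite // -sxy.
  apply/rs/connE => //; rewrite !inE ?Ex ?Ey andbT.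
    by apply: contraNneq sx => ->.
  by apply: contraNneq sx => <-; rewrite sxy.
Qed.

(** An edge alone at its vertex is a cycle of length one, so a rotation fixes it just as it fixes a
    non-edge. *)
Lemma is_rotation_single E s e :
    e \in E -> (forall e', e' \in E -> side e' = side e -> e' = e) ->
  is_rotation side E s = is_rotation side (E :\ e) s.
Proof.
move=> Ee e1; apply/is_rotationP/is_rotationP => -[fixE stabE connE].
  have se : s e = e by apply: e1; case: (stabE e Ee).
  split=> [z|z|x y].
  - by rewrite !inE negb_and negbK => /orP[/eqP -> //|/fixE].
  - have sze : (s z == e) = (z == e) by rewrite -[X in s z == X]se (inj_eq perm_inj).
    by rewrite !inE sze => /andP[-> /stabE].
  - by move=> /setD1P[_ Ex] /setD1P[_ Ey]; apply: connE.
have se : s e = e by apply: fixE; rewrite !inE eqxx.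
split=> [z Ez|z Ez|x y Ex Ey sxy].
- by apply: fixE; rewrite !inE (negPf Ez) andbF.
- have [-> | ze] := eqVneq z e; first by rewrite se.
  by case: (stabE z) => [|/setD1P[_]] //; rewrite !inE ze.
- have [xe | xe] := eqVneq x e.
    by rewrite (e1 y) ?xe ?connect0 // -sxy xe.
  apply: connE; rewrite ?inE ?xe ?Ex ?Ey ?andbT //.
  by apply: contraNneq xe => ye; apply/eqP/e1; rewrite // sxy ye.
Qed.

Lemma is_rotation0 s : is_rotation side set0 s = (s == 1%g).
Proof.
apply/is_rotationP/eqP => [[fixE _ _]|->].
  by apply/permP=> z; rewrite perm1 fixE ?inE.
by split=> [z|z|x y]; rewrite ?inE ?perm1.
Qed.

Definition side_deg E v := #|[set e in E | side e == v]|.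

Lemma side_degD1 E e v :
  e \in E -> side_deg E v = (side e == v) + side_deg (E :\ e) v.
Proof.
move=> Ee; rewrite /side_deg (cardsD1 e) !inE Ee; congr (_ + _).
by apply: eq_card => z; rewrite !inE andbA.
Qed.

(** Induction on the number of edges. A rotation of [E :\ e] extends to [E] by inserting [e] after
    any other edge at its vertex, or in one way if there is none; a vertex with k edges thus
    collects (k - 1)!. Vertices without edges contribute 0!, as [0.-1] is 0. *)
Lemma card_rotations E :
  #|[set s | is_rotation side E s]| = \prod_v (side_deg E v).-1`!.
Proof.
have [k] := ubnP #|E|; elim: k E => // k IHk E.
have [-> _ | [e Ee]] := set_0Vmem E.
  rewrite big1 => [|v _]; last first.
    by rewrite /side_deg (eq_card0 (A := [set _ in _ | _])) // => z; rewrite !inE.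
  by rewrite -(cards1 (1%g : {perm 'I_n * 'I_m})); apply: eq_card => s;
    rewrite !inE is_rotation0.
rewrite (cardsD1 e) Ee ltnS => /IHk IH.
set D := [set e' in E :\ e | side e' == side e].
have degE' : side_deg (E :\ e) (side e) = #|D| by [].
(* [maxn] merges two cases: with [D] empty both factorials at this vertex are 0!, otherwise the
   factor is the quotient of consecutive factorials. *)
have -> : \prod_v (side_deg E v).-1`! =
          maxn 1 #|D| * \prod_v (side_deg (E :\ e) v).-1`!.
  rewrite (bigD1 (side e)) //= [in RHS](bigD1 (side e)) //= mulnA.
  rewrite (side_degD1 _ Ee) eqxx degE' /=; congr (_ * _).
    by case: #|D| => // d; rewrite (maxn_idPr _) // -factS.
  apply: eq_bigr => v /negPf vse.
  by rewrite (side_degD1 _ Ee) eq_sym vse.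
rewrite -{}IH; have [D0 | [e0 De0]] := set_0Vmem D.
  rewrite D0 cards0 mul1n; apply: eq_card => s; rewrite !inE.
  apply: is_rotation_single Ee _ => e' Ee' see'; apply/eqP/negPn/negP => e'e.
  by have := in_set0 e'; rewrite -D0 !inE e'e Ee' see' eqxx.
have -> : maxn 1 #|D| = #|D| by apply/maxn_idPr/card_gt0P; exists e0.
(* Rotations are classified by the edge preceding [e], which must lie in [D]. *)
rewrite -sum1_card (partition_big (fun s => s^-1%g e) (mem D)) /=; last first.
  move=> s; rewrite inE => /is_rotationP[fixE stabE connE].
  have Es : s^-1%g e \in E.
    by apply: contraLR Ee => Es; rewrite -(permKV s e) (fixE _ Es).
  have [_ side_s] := stabE _ Es; rewrite permKV in side_s.
  rewrite !inE Es -side_s eqxx !andbT; apply/eqP => se.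
  (* If [e] were its own predecessor, its cycle would miss [e0], another edge at the same vertex. *)
  have {}se : s e = e by rewrite -[in LHS]se permKV.
  have /setIdP[/setD1P[e0e Ee0] /eqP see0] := De0.
  have: e0 = e; last exact/eqP.
  apply: (@connect_invariant _ (frel s) (fun z => z = e) e e0) => //.
    by move=> u v -> /eqP <-.
  exact: connE.
rewrite (eq_bigr (fun=> #|[set s | is_rotation side (E :\ e) s]|)).
  by rewrite sum_nat_const.
move=> e' /setIdP[/setD1P[e'e Ee'] /eqP see'].
(* Left multiplication by the transposition matches the rotations of [E :\ e] with those of [E]
   where [e] follows [e']. *)
rewrite -sum1_card (reindex_inj (mulgI (tperm e' e))) /=.
apply: eq_bigl => s; rewrite !inE -(is_rotation_insert s Ee Ee' e'e see').
by rewrite (canF_eq (permKV _)) [_ == e]eq_sym.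
Qed.
End Rotations.

(** * Trees with prescribed vertex degrees *)

Section Trees.
Variables (n m : nat).
Local Notation vertex := ('I_n + 'I_m)%type.
Local Notation edge := ('I_n * 'I_m)%type.
Implicit Types (x y z : vertex) (e f : edge) (E : {set edge}) (d : vertex -> nat).

Definition incident x e :=
  match x with inl i => e.1 == i | inr j => e.2 == j end.

Definition white x := if x is inl _ then true else false.

Definition other_end x e : vertex :=
  if x is inl _ then inr e.2 else inl e.1.

Definition degree E x := #|[set e in E | incident x e]|.

Lemma incident_other x e z :
  incident x e -> incident z e = (z == x) || (z == other_end x e).
Proof. by case: x z => [i|j] [k|l] /= /eqP xe; rewrite /eq_op /= -?xe ?orbF eq_sym. Qed.

Lemma other_endK x e : incident x e -> other_end (other_end x e) e = x.
Proof. by case: x => [i|j] /= /eqP ->. Qed.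

Lemma other_end_neq x e : other_end x e != x.
Proof. by case: x. Qed.

Lemma btree_adjP E x y :
  reflect (exists2 e, e \in E & incident x e /\ y = other_end x e)
          (btree_adj E x y).
Proof.
apply: (iffP idP) => [|[[a b] Ee []]].
  by case: x y => [i|j] [k|l] //= Ee; [exists (i, l) | exists (k, j)].
by case: x => [i|j] /= /eqP <- -> //=.
Qed.

Lemma btree_adj_connect_sym E : connect_sym (btree_adj E).
Proof. by apply: sym_connect_sym => -[i|j] [k|l]. Qed.

Lemma btree_adj_subset E E' :
  E \subset E' -> subrel (connect (btree_adj E)) (connect (btree_adj E')).
Proof.
move=> /subsetP sEE'; apply: connect_sub => x y /btree_adjP[e Ee xe].
by apply/connect1/btree_adjP; exists e; first exact: sEE'.
Qed.

Lemma degreeD1 E e x :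
  e \in E -> degree E x = incident x e + degree (E :\ e) x.
Proof. by case: x => v; apply: side_degD1. Qed.

Lemma incident_degree_gt0 E e x : e \in E -> incident x e -> 0 < degree E x.
Proof. by move=> Ee xe; rewrite (degreeD1 _ Ee) xe. Qed.

Lemma degree1_uniq E e f x : degree E x = 1 ->
  e \in E -> incident x e -> f \in E -> incident x f -> f = e.
Proof.
move=> d1 Ee xe Ef xf; apply/eqP/negPn/negP => fe.
have: 0 < degree (E :\ e) x by apply: (@incident_degree_gt0 _ f); rewrite ?inE ?fe.
by move: d1; rewrite (degreeD1 _ Ee) xe; case: degree.
Qed.

(* The trees whose vertex set is the support of [d], with degree function [d]. *)
Definition trees_of_degree d : {set {set edge}} :=
  [set E | [forall x, degree E x == d x] &&
           [forall x, forall y, (0 < d x) && (0 < d y) ==>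
              connect (btree_adj E) x y]].

Lemma trees_of_degreeP d E :
  reflect ((forall x, degree E x = d x) /\
           (forall x y, 0 < d x -> 0 < d y -> connect (btree_adj E) x y))
          (E \in trees_of_degree d).
Proof.
rewrite inE; apply: (iffP andP) => -[dE cE]; split.
- by move=> x; apply/eqP/(forallP dE).
- by move=> x y dx dy; apply: (implyP (forallP (forallP cE x) y)); rewrite dx.
- by apply/forallP=> x; rewrite dE.
- apply/forallP=> x; apply/forallP=> y; apply/implyP=> /andP[]; exact: cE.
Qed.

(** The vertex types stay fixed during the induction: a deleted leaf becomes a vertex of degree 0,
    outside the support. *)
Definition drop_edge d e : vertex -> nat := fun z => d z - incident z e.

(** * Adding and removing a leaf *)

Section Leaf.
Variables (d : vertex -> nat) (x : vertex) (e : edge).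
Hypotheses (dx : d x = 1) (xe : incident x e).
Let y := other_end x e.

Let ye : incident y e.
Proof. by rewrite (incident_other _ xe) eqxx orbT. Qed.

Let yx : y != x. Proof. exact: other_end_neq. Qed.

(** In the smaller tree [x] has degree 0, so [e] is new. The bound [1 < d y] keeps [y] in the
    support after the drop, so every supported vertex still reaches it. *)
Lemma add_leaf E :
    1 < d y -> E \in trees_of_degree (drop_edge d e) ->
  e \notin E /\ e |: E \in trees_of_degree d.
Proof.
move=> dy /trees_of_degreeP[dE cE].
have eE : e \notin E.
  apply/negP => /incident_degree_gt0 /(_ xe).
  by rewrite dE /drop_edge dx xe.
split=> //; apply/trees_of_degreeP.
have E'e : e \in e |: E by rewrite setU11.
split=> [z|].
  rewrite (degreeD1 _ E'e) setU1K // dE subnKC // (incident_other _ xe).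
  by have [-> | _] := eqVneq z x; [rewrite dx | have [-> | _] := eqVneq z y; lia].
have toy u : 0 < d u -> connect (btree_adj (e |: E)) u y.
  move=> du; have [-> | ux] := eqVneq u x.
    by apply/connect1/btree_adjP; exists e.
  apply: (@btree_adj_subset E); first exact: subsetUr.
  apply: cE; rewrite /drop_edge ?ye ?subn_gt0 //.
  rewrite (incident_other _ xe) (negPf ux) -/y.
  by have [-> | _] := eqVneq u y; lia.
move=> u v du dv; apply: connect_trans (toy u du) _.
by rewrite btree_adj_connect_sym toy.
Qed.

(** A third supported vertex [z] is reached from [x] only through [y], which forces [1 < d y]; paths
    between other vertices can avoid the dead end [x]. *)
Lemma remove_leaf E z :
    0 < d z -> z != x -> z != y -> E \in trees_of_degree d -> e \in E ->
  1 < d y /\ E :\ e \in trees_of_degree (drop_edge d e).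
Proof.
move=> dz zx zy /trees_of_degreeP[dE cE] Ee.
have e1 f : f \in E -> incident x f -> f = e.
  by apply: degree1_uniq => //; rewrite dE.
split.
  rewrite ltnNge; apply/negP => dy1.
  have dy : d y = 1.
    by apply/eqP; rewrite eqn_leq dy1 -dE (incident_degree_gt0 Ee ye).
  have: z = x \/ z = y; last by case=> /eqP; apply/negP.
  (* With both degrees equal to 1, [x] and [y] would form a component without [z]. *)
  apply: (@connect_invariant _ (btree_adj E) (fun z => z = x \/ z = y) x z).
  - move=> u v [] -> /btree_adjP[f Ef [uf ->]].
      by right; rewrite (e1 f).
    left; rewrite (@degree1_uniq E e f y) ?dE // /y other_endK //.
  - by left.
  - by apply: cE; rewrite ?dx.
apply/trees_of_degreeP; split=> [w|u v].
  by rewrite /drop_edge -dE (degreeD1 _ Ee) addKn.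
have supp w : 0 < drop_edge d e w -> 0 < d w /\ w != x.
  move=> dw; split; first by apply: leq_trans dw (leq_subr _ _).
  by apply: contraTneq dw => ->; rewrite /drop_edge dx xe.
move=> /supp[du ux] /supp[dv vx].
(* A path visiting [x] comes from [y] and returns to it; contracting [x] onto [y] removes the
   detour. *)
pose P w := connect (btree_adj (E :\ e)) u (if w == x then y else w).
have: P v; last by rewrite /P (negPf vx).
apply: (@connect_invariant _ (btree_adj E) P u v) (cE _ _ du dv); last first.
  by rewrite /P (negPf ux) connect0.
move=> w w' + /btree_adjP[f Ef [wf ->]]; rewrite /P.
have [wx | wx] := eqVneq w x.
  by rewrite wx in wf *; rewrite (e1 f) // (negPf yx).
have [w'x | w'x] := eqVneq (other_end w f) x => Pw.
  have fe : f = e by apply: e1 => //; rewrite (incident_other _ wf) w'x eqxx orbT.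
  move: wf; rewrite fe (incident_other _ xe) (negPf wx) /= => /eqP wy.
  by rewrite /y -wy.
apply: connect_trans Pw (connect1 _); apply/btree_adjP; exists f => //.
rewrite !inE Ef andbT; apply: contraNneq w'x => fe.
move: wf; rewrite fe (incident_other _ xe) (negPf wx) /= => /eqP ->.
by rewrite other_endK.
Qed.

(** Deleting [e] and adding it back are mutually inverse. The boolean factor covers [d y <= 1],
    where no tree containing [e] could reach [z]. *)
Lemma card_trees_with_leaf z : 0 < d z -> z != x -> z != y ->
  #|[set E in trees_of_degree d | e \in E]| =
  (1 < d y) * #|trees_of_degree (drop_edge d e)|.
Proof.
move=> dz zx zy; have [dy | dy] := boolP (1 < d y); last first.
  rewrite mul0n; apply/eqP; rewrite cards_eq0; apply/eqP/setP => E.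
  rewrite in_set0; apply/negP => /setIdP[tE Ee].
  by case: (remove_leaf dz zx zy tE Ee) => dy'; rewrite dy' in dy.
have -> : [set E in trees_of_degree d | e \in E] =
          [set e |: E | E in trees_of_degree (drop_edge d e)].
  apply/setP => E; apply/setIdP/imsetP => [[tE Ee]|[E' tE' ->]].
    exists (E :\ e); last by rewrite setD1K.
    by case: (remove_leaf dz zx zy tE Ee).
  by case: (add_leaf dy tE') => _ ->; rewrite setU11.
rewrite mul1n card_in_imset //.
move=> E1 E2 /(add_leaf dy)[eE1 _] /(add_leaf dy)[eE2 _] eq12.
by rewrite -(setU1K eE1) eq12 setU1K.
Qed.
End Leaf.

(** * Sums and products over vertices, by colour and after dropping an edge *)

Lemma sum_color (F : vertex -> nat) :
  \sum_(x | white x == true) F x + \sum_(x | white x == false) F x = \sum_x F x.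
Proof.
rewrite [RHS](bigID white) /=; congr (_ + _); apply: eq_bigl => z.
  by rewrite eqb_id.
by rewrite eqbF_neg.
Qed.

Lemma sum_incident_color e b : \sum_(z | white z == b) incident z e = 1.
Proof.
case: e => i j; pose x : vertex := if b then inl i else inr j.
have xb : white x = b by rewrite /x; case: (b).
rewrite (bigD1 x) ?xb //= big1 => [|z /andP[/eqP zb zx]].
  by rewrite /x; case: (b) => /=; rewrite eqxx.
move: zb zx; rewrite /x; case: (b) z => -[k|l] //= _ zx;
  by apply/eqP; rewrite eqb0; apply: contraNN zx => /eqP ->.
Qed.

(** All candidate edges at [x], not only those of some tree, are parametrised by their end of the
    opposite colour. *)
Lemma sum_other_end x (F : vertex -> nat) :
  \sum_(e | incident x e) F (other_end x e) =
  \sum_(z | white z == ~~ white x) F z.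
Proof.
rewrite [RHS]big_sumType /=; case: x => [i|j] /=.
  rewrite (eq_bigl (fun e : edge => (e.1 == i) && true)); last by move=> e; rewrite andbT.
  rewrite -(pair_big (fun k => k == i) xpredT (fun k l => F (inr l))) /=.
  by rewrite big_pred1_eq big_pred0_eq.
rewrite (eq_bigl (fun e : edge => true && (e.2 == j))) //.
rewrite -(pair_big xpredT (fun l => l == j) (fun k l => F (inl k))) /=.
rewrite big_pred0_eq addn0; apply: eq_bigr => k _; exact: big_pred1_eq.
Qed.

Lemma drop_edgeK d x e z : d x = 1 -> incident x e -> 0 < d (other_end x e) ->
  d z = drop_edge d e z + incident z e.
Proof.
move=> dx xe dy; rewrite subnK // (incident_other _ xe).
by have [-> | _] := eqVneq z x; [rewrite dx | have [-> | _] := eqVneq]; lia.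
Qed.

Lemma gt0_drop_edge d x e z : d x = 1 -> incident x e -> 1 < d (other_end x e) ->
  (0 < d z) = (0 < drop_edge d e z) + (z == x) :> nat.
Proof.
move=> dx xe dy; rewrite /drop_edge (incident_other _ xe).
have [-> | _] := eqVneq z x; first by rewrite dx.
by have [-> | _] := eqVneq z (other_end x e); lia.
Qed.

(** Only the factor at the neighbour of [x] changes: at [x] the degree falls from 1 to 0, and both
    values give 0!. *)
Lemma prod_drop_edge d x e : d x = 1 -> incident x e -> 1 < d (other_end x e) ->
  \prod_z (d z).-1`! =
  (d (other_end x e)).-1 * \prod_z (drop_edge d e z).-1`!.
Proof.
move=> dx xe dy; set y := other_end x e in dy *.
rewrite (bigD1 y) //= [in RHS](bigD1 y) //= mulnA; congr (_ * _).
  rewrite /drop_edge (incident_other _ xe) eqxx orbT.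
  by case: (d y) dy => [|[|k]] //= _; rewrite subn1 factS.
apply: eq_bigr => z /negPf zy; rewrite /drop_edge (incident_other _ xe) -/y zy orbF.
by have [-> | _] := eqVneq z x; [rewrite dx | rewrite subn0].
Qed.

(** * The weighted number of trees with a given degree function *)

Lemma card_trees_edge d e : d =1 (fun z => nat_of_bool (incident z e)) ->
  #|trees_of_degree d| = 1.
Proof.
move=> dE; rewrite -(cards1 [set e]); apply: eq_card => E; rewrite in_set1.
apply/trees_of_degreeP/eqP => [[degE _]|->].
  have sub f : f \in E -> f = e.
    move=> Ef; have := incident_degree_gt0 (x := inl f.1) Ef (eqxx _).
    have := incident_degree_gt0 (x := inr f.2) Ef (eqxx _).
    rewrite !degE !dE !lt0b /= => /eqP e2 /eqP e1.
    by case: e f e1 e2 {dE Ef} => a b [c g] /= -> ->.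
  apply/setP => f; rewrite in_set1; apply/idP/eqP => [/sub //|->].
  have: 0 < degree E (inl e.1) by rewrite degE dE /= eqxx.
  by case/card_gt0P => g /setIdP[Eg _]; rewrite -(sub g Eg).
split=> [x|x y]; last first.
  rewrite !dE !lt0b => xe; rewrite (incident_other _ xe) => /orP[]/eqP ->.
    exact: connect0.
  by apply/connect1/btree_adjP; exists e; rewrite ?set11.
rewrite (degreeD1 _ (set11 e)) dE setDv /degree.
by rewrite (eq_card0 (A := [set _ in _ | _])) ?addn0 // => f; rewrite !inE.
Qed.

(** [N.+1] counts edges and [N.+2] supported vertices; both fall by one when a leaf is deleted,
    hence the induction on [N]. *)
Lemma card_trees_of_degree N d :
    (forall b, \sum_(x | white x == b) d x = N.+1) ->
    \sum_x (0 < d x) = N.+2 ->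
  #|trees_of_degree d| * \prod_x (d x).-1`! =
  (\sum_(x | white x == true) (0 < d x)).-1`! *
  (\sum_(x | white x == false) (0 < d x)).-1`!.
Proof.
elim: N d => [|N IHN] d sumd suppd.
  (* A single edge: each colour has degree sum 1, so exactly one supported vertex. *)
  have uniq_color b : exists2 x, white x = b &
      forall z, white z = b -> d z = (z == x).
    have /eqP := sumd b; case/sum_nat_eq1 => x [/eqP xb dx dz].
    exists x => // z zb; have [-> // | zx] := eqVneq z x.
    by rewrite dz // zb.
  have [[i|//] _ di] := uniq_color true.
  have [[//|j] _ dj] := uniq_color false.
  have de : d =1 (fun z => nat_of_bool (incident z (i, j))).
    by case=> [k|l]; [rewrite di | rewrite dj] => //; rewrite eq_sym.
  rewrite (card_trees_edge de) mul1n.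
  rewrite big1 => [|z _]; last by rewrite de; case: incident.
  have s1 b : \sum_(x | white x == b) (0 < d x) = 1.
    rewrite -[RHS](sum_incident_color (i, j) b); apply: eq_bigr => z _.
    by rewrite de lt0b.
  by rewrite !s1.
(* Otherwise all [N.+3] supported vertices have degree at least 2, while the degrees add up to only
   2(N + 2). *)
have [x dx] : exists x, d x = 1.
  have [/existsP[x /eqP dx] | no1] := boolP [exists x, d x == 1]; first by exists x.
  have: \sum_x (0 < d x) * 2 <= \sum_x d x.
    apply: leq_sum => x _; move: no1; rewrite negb_exists => /forallP/(_ x).
    by case: (d x) => [|[|k]].
  by rewrite -big_distrl /= suppd -sum_color !sumd; lia.
have suppC := esym (sum_color (fun z => 0 < d z : nat)); rewrite suppd in suppC.
set s := fun b => \sum_(z | white z == b) (0 < d z) in suppC *.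
have {}suppC : s (white x) + s (~~ white x) = N.+3.
  by rewrite suppC; case: (white x) => //; apply: addnC.
transitivity ((s (white x)).-1`! * (s (~~ white x)).-1`!); last first.
  by case: (white x) => //; apply: mulnC.
(* The degrees of this colour sum to [N.+2], and [x] supplies only 1. *)
have s_gt1 : 1 < s (white x).
  rewrite /s (bigD1 x) //= dx add1n ltnS lt0n; apply/negP.
  rewrite sum_nat_eq0 => /forall_inP d0; have := sumd (white x).
  rewrite (bigD1 x) //= dx big1 // => z /d0; by case: (d z).
have third y : exists z, [/\ 0 < d z, z != x & z != y].
  have [/existsP[z /and3P[]] | no3] :=
    boolP [exists z, [&& 0 < d z, z != x & z != y]]; first by exists z.
  have: \sum_z (0 < d z) <= \sum_z ((z == x) + (z == y)).
    apply: leq_sum => z _; move: no3; rewrite negb_exists => /forallP/(_ z).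
    by case: (0 < d z) (z == x) (z == y) => [] [] [].
  rewrite suppd big_split /= -!big_mkcond /=.
  by rewrite !sum1_card !card1.
have -> : #|trees_of_degree d| = \sum_(e | incident x e)
    (1 < d (other_end x e)) * #|trees_of_degree (drop_edge d e)|.
  transitivity (\sum_(e | incident x e) #|[set E in trees_of_degree d | e \in E]|).
    (* Each tree is counted once, through its unique edge at the leaf [x]. *)
    rewrite -sum1_card (eq_bigr (fun E => \sum_(e | incident x e) (e \in E))).
      rewrite exchange_big /=; apply: eq_bigr => e _.
      rewrite -big_mkcondr /= -sum1_card; apply: eq_bigl => E.
      by rewrite inE.
    move=> E /trees_of_degreeP[degE _]; rewrite -dx -degE -big_mkcondr /=.
    by rewrite sum1_card; apply: eq_card => e; rewrite !inE andbC.
  apply: eq_bigr => e xe; have [z [dz zx zy]] := third (other_end x e).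
  exact: card_trees_with_leaf dz zx zy.
(* By induction a summand depends on [e] only through the neighbour's degree minus one. If that
   degree is at most 1, both sides vanish, by the boolean factor and the truncated predecessor. *)
rewrite big_distrl /= (eq_bigr (fun e => (d (other_end x e)).-1 *
   ((s (white x)).-2`! * (s (~~ white x)).-1`!))); last first.
  move=> e xe; have [dy | dy] := boolP (1 < d (other_end x e)); last first.
    by rewrite !mul0n (_ : _.-1 = 0) ?mul0n //; lia.
  rewrite (prod_drop_edge dx xe dy) mul1n mulnCA; congr (_ * _).
  have sE b : s b = \sum_(z | white z == b) (0 < drop_edge d e z) + (white x == b).
    rewrite /s (eq_bigr _ (fun z _ => gt0_drop_edge z dx xe dy)) big_split /=.
    congr (_ + _); have [xb | xb] := eqVneq (white x) b.
      rewrite (bigD1 x) ?xb //= eqxx big1 // => z /andP[_ /negPf -> //].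
    rewrite big1 // => z /eqP zb; have [zx | //] := eqVneq z x.
    by rewrite -zb zx eqxx in xb.
  have dropE z := drop_edgeK z dx xe (ltnW dy).
  have sumD b : \sum_(z | white z == b) drop_edge d e z = N.+1.
    have := sumd b; rewrite (eq_bigr _ (fun z _ => dropE z)) big_split /=.
    by rewrite sum_incident_color addn1 => -[].
  have suppD : \sum_z (0 < drop_edge d e z) = N.+2.
    by rewrite -sum_color; have := sE true; have := sE false; case: (white x) suppC => /=; lia.
  rewrite (IHN _ sumD suppD) !sE eqxx.
  by case: (white x) => /=; rewrite addn0 addn1 // mulnC.
rewrite -big_distrl /= (sum_other_end x (fun z => (d z).-1)).
(* The opposite colour has degree sum [N.+2]; subtracting its supported vertices leaves one less
   than those of the colour of [x], as the two numbers total [N.+3]. *)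
have -> : \sum_(z | white z == ~~ white x) (d z).-1 = (s (white x)).-1.
  have: \sum_(z | white z == ~~ white x) ((d z).-1 + (0 < d z)) = N.+2.
    rewrite -(sumd (~~ white x)); apply: eq_bigr => z _; by case: (d z) => // k; rewrite addn1.
  by rewrite big_split /= -/(s _); lia.
by rewrite mulnA; case: (s (white x)) s_gt1 => [|[|k]] //= _; rewrite factS.
Qed.
End Trees.

(** * Plane trees as trees weighted by their numbers of rotations *)

Section Plane.
Variables (n m : nat).
Local Notation vertex := ('I_n + 'I_m)%type.
Local Notation edge := ('I_n * 'I_m)%type.
Implicit Types (E : {set edge}) (x : vertex).

Lemma sum_white (F : vertex -> nat) :
  \sum_(x | white x == true) F x = \sum_i F (inl i).
Proof. by rewrite big_sumType /= [X in _ + X]big_pred0_eq addn0. Qed.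

Lemma sum_black (F : vertex -> nat) :
  \sum_(x | white x == false) F x = \sum_j F (inr j).
Proof. by rewrite big_sumType /= [X in X + _]big_pred0_eq add0n. Qed.

(** White and black rotations are chosen independently, and the product over vertices splits
    accordingly by colour. *)
Lemma card_plane_lbtree :
  #|[pred t | @plane_lbtree n m t]| =
  \sum_(E : {set edge} | is_btree E) \prod_x (degree E x).-1`!.
Proof.
transitivity (\sum_E \sum_sw \sum_sb (@plane_lbtree n m (E, sw, sb) : nat)).
  rewrite pair_bigA pair_bigA -sum1_card big_mkcond /=.
  by apply: eq_bigr => -[[E s] r] _; rewrite inE /=; case: ifP.
rewrite [RHS]big_mkcond; apply: eq_bigr => E _ /=.
case: (is_btree E) => /=; last by rewrite big1 // => s _; rewrite big1.
rewrite big_sumType /= -(card_rotations fst E) -(card_rotations snd E).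
rewrite -!sum1_card !(big_mkcond (fun _ => _ \in _)) /= big_distrlr /=.
apply: eq_bigr => s _; apply: eq_bigr => r _; rewrite !inE.
by do 2!case: is_rotation.
Qed.

(** Double counting: every edge has one end of each colour. *)
Lemma sum_degree_color E b : \sum_(x | white x == b) degree E x = #|E|.
Proof.
transitivity (\sum_(x | white x == b) \sum_(e in E) incident x e).
  apply: eq_bigr => x _; rewrite -big_mkcondr /= sum1_card.
  by apply: eq_card => e; rewrite !inE.
rewrite exchange_big /= -sum1_card; apply: eq_bigr => e _.
exact: sum_incident_color.
Qed.
End Plane.

(** * Degree sequences of trees with [n.+1] white and [m.+1] black vertices *)

Section DegreeSequence.
Variables (n m : nat).
Local Notation vertex := ('I_n.+1 + 'I_m.+1)%type.
Local Notation edge := ('I_n.+1 * 'I_m.+1)%type.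
Local Notation degseq := (n.+1.-tuple 'I_m.+1 * m.+1.-tuple 'I_n.+1)%type.
Implicit Types (E : {set edge}) (x : vertex) (t : degseq).

Lemma is_btree_degree_gt0 E x : is_btree E -> 0 < degree E x.
Proof.
case/andP=> /forallP cE _.
have [y yx] : exists y, y != x.
  by case: x => [i|j]; [exists (inr ord0) | exists (inl ord0)].
have /connectP[[|z p] /=] := forallP (cE x) y; first by move=> _ xy; rewrite xy eqxx in yx.
case/andP=> /btree_adjP[e Ee [xe _]] _ _; exact: incident_degree_gt0 Ee xe.
Qed.

(** There are n + m + 1 edges; subtracting one per vertex of a colour leaves m for white and n for
    black. *)
Lemma is_btree_sum_degree E b : is_btree E ->
  \sum_(x | white x == b) (degree E x).-1 = if b then m else n.
Proof.
move=> tE; have := sum_degree_color E b; have /andP[_ /eqP ->] := tE.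
rewrite (eq_bigr (fun x => (degree E x).-1 + 1)); last first.
  by move=> x _; rewrite addn1 prednK // is_btree_degree_gt0.
rewrite big_split /=; case: b.
  by rewrite [X in _ + X]sum_white sum1_card card_ord; lia.
by rewrite [X in _ + X]sum_black sum1_card card_ord; lia.
Qed.

(* A degree sequence stores each degree minus one. *)
Definition degree_of_degseq t x : nat :=
  match x with inl i => (tnth t.1 i).+1 | inr j => (tnth t.2 j).+1 end.

(** On a tree [inord] loses nothing: a degree minus one is bounded by the colour's total, [m] or
    [n]. *)
Definition degseq_of E : degseq :=
  ([tuple inord (degree E (inl i)).-1 | i < n.+1],
   [tuple inord (degree E (inr j)).-1 | j < m.+1]).

(** Pairs of weak compositions, of [m] into [n.+1] parts and of [n] into [m.+1] parts. *)
Definition valid_degseq t := (\sum_(i <- t.1) i == m) && (\sum_(j <- t.2) j == n).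

Lemma degree_of_degseq_of E x : is_btree E ->
  degree_of_degseq (degseq_of E) x = degree E x.
Proof.
move=> tE; have le_sum b : white x = b -> (degree E x).-1 <= if b then m else n.
  by move=> xb; rewrite -(is_btree_sum_degree b tE) (bigD1 x) ?xb //= leq_addr.
have gt0 := is_btree_degree_gt0 x tE.
by case: x le_sum gt0 => [i|j] le_sum gt0 /=; 
  rewrite tnth_mktuple inordK ?ltnS ?(le_sum _ erefl) // prednK.
Qed.

Lemma degseq_of_valid E : is_btree E -> valid_degseq (degseq_of E).
Proof.
move=> tE; rewrite /valid_degseq !big_tuple; apply/andP; split; apply/eqP.
  rewrite -[RHS](is_btree_sum_degree true tE) sum_white; apply: eq_bigr => i _.
  by rewrite -(degree_of_degseq_of (inl i) tE).
rewrite -[RHS](is_btree_sum_degree false tE) sum_black; apply: eq_bigr => i _.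
by rewrite -(degree_of_degseq_of (inr i) tE).
Qed.

Lemma sum_degree_of_degseq t b : valid_degseq t ->
  \sum_(x | white x == b) degree_of_degseq t x = (n + m).+1.
Proof.
case/andP; rewrite !big_tuple => /eqP t1 /eqP t2.
by case: b; rewrite (sum_white, sum_black) /=;
  under eq_bigr do rewrite -addn1; rewrite big_split /= ?t1 ?t2 sum1_card card_ord; lia.
Qed.

(** All degrees are positive, so the support is the whole vertex set, and the edge count of a tree
    follows from the degree sum of one colour. *)
Lemma btree_with_degseq t E : valid_degseq t ->
  is_btree E && (degseq_of E == t) = (E \in trees_of_degree (degree_of_degseq t)).
Proof.
move=> vt; have dt0 x : 0 < degree_of_degseq t x by case: x.
apply/andP/trees_of_degreeP => [[tE /eqP <-]|[dE cE]].
  split=> [x|x y _ _]; first by rewrite degree_of_degseq_of.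
  by case/andP: tE => /forallP/(_ x)/forallP/(_ y).
split.
  apply/andP; split; first by apply/'forall_forallP => x y; apply: cE.
  rewrite -(sum_degree_color E true) (eq_bigr _ (fun x _ => dE x)).
  by rewrite sum_degree_of_degseq // addSn addnS.
apply/eqP; case: t vt dt0 dE cE => p q vt dt0 dE cE; congr (_, _).
  by apply: eq_from_tnth => i; rewrite tnth_mktuple dE /= inord_val.
by apply: eq_from_tnth => i; rewrite tnth_mktuple dE /= inord_val.
Qed.

Lemma card_trees_with_degseq t : valid_degseq t ->
  #|trees_of_degree (degree_of_degseq t)| * \prod_x (degree_of_degseq t x).-1`! =
  n`! * m`!.
Proof.
move=> vt; have dt0 x : (0 < degree_of_degseq t x) = true by case: x.
have c1 b : \sum_(x | white x == b) (0 < degree_of_degseq t x) = if b then n.+1 else m.+1.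
  by case: b; rewrite (sum_white, sum_black) /= sum1_card card_ord.
rewrite (@card_trees_of_degree _ _ (n + m)) ?c1 //.
  by move=> b; apply: sum_degree_of_degseq.
by rewrite -sum_color !c1 addSn addnS.
Qed.

Lemma card_valid_degseq : #|[set t | valid_degseq t]| = 'C(n + m, n) * 'C(m + n, m).
Proof.
rewrite -(card_ord_partitions n m) -(card_ord_partitions m n) -cardsX.
by apply: eq_card => -[p q]; rewrite !inE.
Qed.
End DegreeSequence.

(** * Summation over degree sequences *)

Theorem theorem2p1 (n m : nat) (hn : 0 < n) (hm : 0 < m) :
  #|[pred t | @plane_lbtree n m t]| * ((n.-1)`! * (m.-1)`!) = ((n + m - 2)`!) ^ 2.
Proof.
case: n m hn hm => [//|n] [//|m] _ _; rewrite addSn addnS subn2 /=.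
rewrite card_plane_lbtree.
rewrite (partition_big (@degseq_of n m) (@valid_degseq n m)) /=; last first.
  by move=> E; apply: degseq_of_valid.
(* Every degree sequence carries the same total weight. *)
rewrite (eq_bigr (fun=> n`! * m`!)) => [|t vt].
  rewrite sum_nat_cond_const card_valid_degseq.
  have binE p q : 'C(p + q, p) * (p`! * q`!) = (p + q)`!.
    by rewrite -(bin_fact (leq_addr q p)) addKn.
  (* One product of factorials comes from the common weight, the other from the denominator; each
     completes one binomial to (n + m)!. *)
  by rewrite -mulnA mulnACA binE (mulnC n`!) binE addnC mulnn.
rewrite -(card_trees_with_degseq vt) -sum_nat_const.
apply: eq_big => [E|E /andP[tE /eqP <-]]; first exact: btree_with_degseq.
by apply: eq_bigr => x _; rewrite degree_of_degseq_of.
Qed.
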